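(* For every $\eta>0$ the following hold. (i) There exist a compact convex set $\Omega\subset\mathbb R^2$ with non-empty interior and a unit vector $\theta\in\mathbb R^2$ such that $\bigl|\langle c(\partial\Omega)-c(\Omega),\theta\rangle\bigr|>\left(\frac16-\eta\right)w_\Omega(\theta)$. (ii) There exists a compact convex set $\Omega\subset\mathbb R^2$ with non-empty interior such that $\bigl|c(\partial\Omega)-c(\Omega)\bigr|>\left(\frac16-\eta\right)d(\Omega)$. (iii) There exists a compact convex set $\Omega\subset\mathbb R^2$ with non-empty interior such that $\bigl|c(\partial\Omega)-c(\Omega)\bigr|>\left(\frac1{12}-\eta\right)\mathrm{length}(\partial\Omega)$.
   Context: $c(\Omega)$ denotes the center of mass of $\Omega$ with respect to area (Lebesgue measure), and $c(\partial\Omega)$ denotes the center of mass of the boundary curve $\partial\Omega$ with respect to arc length (one-dimensional Hausdorff measure). For a unit vector $\theta$, $w_\Omega(\theta)=\max_{z\in\Omega}\langle z,\theta\rangle-\min_{z\in\Omega}\langle z,\theta\rangle$ is the width of $\Omega$ in the direction $\theta$. $d(\Omega)$ is the diameter of $\Omega$, $\mathrm{length}(\partial\Omega)$ is the perimeter of $\Omega$, and $|\cdot|$ is the Euclidean norm. *)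

(* Defs.v *)
From HB Require Import structures.
From mathcomp Require Import all_boot all_order all_algebra.
From mathcomp Require Import all_classical all_reals all_analysis.

Set Implicit Arguments.
Unset Strict Implicit.
Unset Printing Implicit Defensive.
Import Order.TTheory GRing.Theory Num.Theory.
Import numFieldNormedType.Exports.

Local Open Scope classical_set_scope.
Local Open Scope ring_scope.

(* The plane is R * R. Its library norm is the sup norm, so the Euclidean norm
   is introduced here; the two induce the same topology, hence compact, closure
   and interior below are the usual ones. *)
Definition dotp (R : realType) (z w : R * R) : R := z.1 * w.1 + z.2 * w.2.

Definition enorm (R : realType) (z : R * R) : R := Num.sqrt (dotp z z).

(* The extended diameter, with the convention that the empty set has diameter
   0. *)
Definition ediam (R : realType) (A : set (R * R)) : \bar R :=
  maxe 0%E (ereal_sup [set (enorm (z.1 - z.2))%:E | z in A `*` A]).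

Section hausdorff.
Context {R : realType}.
Implicit Types (A : set (R * R)) (F : (set (R * R))^nat) (delta : R).
Local Open Scope ereal_scope.

Definition small_cover delta A : set ((set (R * R))^nat) :=
  [set F | (forall k, ediam (F k) <= delta%:E) /\ A `<=` \bigcup_k F k].

Definition hausdorff1_pre delta A : \bar R :=
  ereal_inf [set \sum_(k <oo) ediam (F k) | F in small_cover delta A].

Definition hausdorff1 A : \bar R :=
  ereal_sup [set hausdorff1_pre delta A | delta in [set d | (0 < d)%R]].

Lemma ediam_ge0 A : 0 <= ediam A.
Proof. by rewrite /ediam le_max lexx. Qed.

Lemma ediam0 : ediam (@set0 (R * R)) = 0.
Proof. by rewrite /ediam setX0 image_set0 ereal_sup0; apply/max_idPl; rewrite leNye. Qed.

Lemma hausdorff1_pre_ge0 delta A : 0 <= hausdorff1_pre delta A.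
Proof.
apply: le_ereal_inf_tmp => x [F _ <-].
by apply: nneseries_ge0 => n _ _; exact: ediam_ge0.
Qed.

Lemma le_hausdorff1_pre delta :
  {homo hausdorff1_pre delta : A B / A `<=` B >-> A <= B}.
Proof.
move=> A B AB; apply/ereal_inf_le_tmp => x [F [dF BF] <-].
by exists F => //; split => //; exact: subset_trans BF.
Qed.

Lemma hausdorff1_pre0 delta : (0 < delta)%R -> hausdorff1_pre delta set0 = 0.
Proof.
move=> d0; apply/eqP; rewrite eq_le hausdorff1_pre_ge0 andbT.
apply: ereal_inf_lbound; exists (fun=> set0).
  by split => // k; rewrite ediam0 lee_fin ltW.
by rewrite eseries0// => k _ _; rewrite ediam0.
Qed.

Lemma hausdorff1_pre_sigma_subadditive delta :
  sigma_subadditive (hausdorff1_pre delta).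
Proof.
move=> A; have [[i ioo]|] := pselect (exists i, hausdorff1_pre delta (A i) = +oo).
  rewrite (eseries_pinfty _ _ ioo) ?leey// => n _.
  by rewrite -ltNye (lt_le_trans _ (hausdorff1_pre_ge0 _ _)).
rewrite -forallNE => Aoo.
apply/lee_addgt0Pr => _/posnumP[e].
rewrite (le_trans _ (epsilon_trick _ _ _))//; last first.
  by move=> n; exact: hausdorff1_pre_ge0.
pose P n F := small_cover delta (A n) F /\
  \sum_(k <oo) ediam (F k) <= hausdorff1_pre delta (A n) + (e%:num / (2 ^ n.+1)%:R)%:E.
have [G PG] : {G : ((set (R * R))^nat)^nat & forall n, P n (G n)}.
  apply: (@choice _ _ P) => n.
  have en1 : (0 < e%:num / (2 ^ n.+1)%:R)%R by [].
  have fA : hausdorff1_pre delta (A n) \is a fin_num.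
    by rewrite ge0_fin_numE ?hausdorff1_pre_ge0// ltey; exact/eqP/Aoo.
  have [x [F cF <-] xS] := lb_ereal_inf_adherent en1 fA.
  by exists F; split => //; exact/ltW.
have G_ge0 x : 0 <= (@ediam R \o uncurry G) x by exact: ediam_ge0.
apply: (@le_trans _ _ (\esum_(i in setT) (@ediam R \o uncurry G) i)).
  apply: ereal_inf_lbound => /=.
  have /card_esym/ppcard_eqP[f] := card_nat2.
  exists (uncurry G \o f).
    split => [i|]; first by rewrite /=; case: (f i) => a b; exact: (PG a).1.1.
    apply: (@subset_trans _  (\bigcup_n \bigcup_k G n k)) => [t [i _ At]|].
      by have [j _ ?] := (PG i).1.2 _ At; exists i => //; exists j.
    move=> t [i _ [j _ Bijt]]; exists (f^-1%FUN (i, j)) => //=.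
    by rewrite invK ?inE.
  rewrite -(esum_pred_image (@ediam R \o uncurry G) _ xpredT) ?[fun=> _]set_true//.
  by rewrite image_eq.
rewrite (_ : esum _ _ = \sum_(i <oo) \sum_(j <oo ) ediam (G i j)); last first.
  pose J : nat -> set (nat * nat) := fun i => [set (i, j) | j in setT].
  rewrite (_ : setT = \bigcup_k J k); last first.
    by rewrite predeqE => -[a b]; split => // _; exists a => //; exists b.
  rewrite esum_bigcupT /=; last 2 first.
    - apply/trivIsetP => i j _ _ ij.
      rewrite predeqE => -[n m] /=; split => //= -[] [_] _ [<-{n} _].
      by move=> [m' _] [] /esym/eqP; rewrite (negbTE ij).
    - by move=> /= [n m]; exact: ediam_ge0.
  rewrite -(image_id [set: nat]) -fun_true esum_pred_image//; last first.
    by move=> n _; apply: esum_ge0 => x _; exact: ediam_ge0.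
  apply: eq_eseriesr => /= j _.
  rewrite -(esum_pred_image (@ediam R \o uncurry G) (pair j) predT)/=; last 2 first.
    by move=> k _; exact: ediam_ge0.
    by move=> ? ? _ _; exact: (@can_inj _ _ _ snd).
  by congr esum; rewrite predeqE => -[a b]; split; move=> [i _ <-]; exists i.
apply: lee_nneseries => n *.
  by apply: nneseries_ge0 => m _ _; exact: ediam_ge0.
exact: (PG n).2.
Qed.

Lemma hausdorff10 : hausdorff1 set0 = 0.
Proof.
apply/eqP; rewrite eq_le; apply/andP; split.
  by apply: ge_ereal_sup => _ [d /= d0 <-]; rewrite hausdorff1_pre0.
by apply: ereal_sup_ubound; exists 1%R => //=; rewrite hausdorff1_pre0.
Qed.

Lemma hausdorff1_pre_le delta A :
  (0 < delta)%R -> hausdorff1_pre delta A <= hausdorff1 A.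
Proof. by move=> d0; apply: ereal_sup_ubound; exists delta. Qed.

Lemma hausdorff1_ge0 A : 0 <= hausdorff1 A.
Proof.
exact: le_trans (hausdorff1_pre_ge0 1 A) (hausdorff1_pre_le A ltr01).
Qed.

Lemma le_hausdorff1 : {homo hausdorff1 : A B / A `<=` B >-> A <= B}.
Proof.
move=> A B AB; apply: ge_ereal_sup => _ [d /= d0 <-].
exact: le_trans (le_hausdorff1_pre d AB) (hausdorff1_pre_le B d0).
Qed.

Lemma hausdorff1_sigma_subadditive : sigma_subadditive hausdorff1.
Proof.
move=> F; apply: ge_ereal_sup => _ [d /= d0 <-].
apply: le_trans (hausdorff1_pre_sigma_subadditive d F) _.
apply: lee_nneseries => n *; first exact: hausdorff1_pre_ge0.
exact: hausdorff1_pre_le.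
Qed.

HB.instance Definition _ := isOuterMeasure.Build R (R * R)%type hausdorff1
  hausdorff10 hausdorff1_ge0 le_hausdorff1 hausdorff1_sigma_subadditive.

End hausdorff.

(* The one-dimensional Hausdorff measure as a measure on its Caratheodory
   sigma-algebra (which contains the Borel sets). *)
Definition hausdorff1_measure (R : realType) :
    {measure set (caratheodory_type (@hausdorff1 R)) -> \bar R} :=
  let mu : {outer_measure set (R * R) -> \bar R} := @hausdorff1 R in
  (mu : set (caratheodory_type mu) -> \bar R).

Definition area (R : realType) (A : set (R * R)) : R :=
  fine ((@lebesgue_measure R \x @lebesgue_measure R)%E A).

Definition area_centroid (R : realType) (A : set (R * R)) : R * R :=
  let mu := (@lebesgue_measure R \x @lebesgue_measure R)%E in
  ((\int[mu]_(z in A) z.1) / area A, (\int[mu]_(z in A) z.2) / area A).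

Definition boundary (R : realType) (A : set (R * R)) : set (R * R) :=
  closure A `\` interior A.

Definition perimeter (R : realType) (A : set (R * R)) : R :=
  fine (hausdorff1 (boundary A)).

Definition boundary_centroid (R : realType) (A : set (R * R)) : R * R :=
  let mu := hausdorff1_measure R in
  ((\int[mu]_(z in boundary A) z.1) / perimeter A,
   (\int[mu]_(z in boundary A) z.2) / perimeter A).

(* For compact nonempty A the supremum and infimum are attained. *)
Definition width (R : realType) (A : set (R * R)) (theta : R * R) : R :=
  sup [set dotp z theta | z in A] - inf [set dotp z theta | z in A].

Definition diameter (R : realType) (A : set (R * R)) : R := fine (ediam A).

Definition convex_body (R : realType) (A : set (R * R)) : Prop :=
  [/\ compact A, @convex_set R (R^o * R^o)%type A & interior A !=set0].

(* Main.v *)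
Require Import Defs.
From mathcomp Require Import all_boot all_order all_algebra.
From mathcomp Require Import all_classical all_reals all_analysis.
From mathcomp Require Import measurable_realfun ring lra.

Import Order.TTheory GRing.Theory Num.Theory.
Import numFieldNormedType.Exports.

Local Open Scope classical_set_scope.
Local Open Scope ring_scope.

(** A thin triangle is extremal in the limit for all three inequalities. Let T
    have vertices (0, 0), (1, 0) and (0, h) with h small. Its area centroid has
    abscissa 1/3 whatever h is (area_centroid_triangle_fst). Its boundary is,
    up to a piece of length h, two copies of the segment [0, 1], so the
    abscissa of the boundary centroid tends to 1/2 as h tends to 0. The gap
    1/2 - 1/3 = 1/6 is to be compared with the width 1 in direction (1, 0), a
    diameter at most 1 + h, and a perimeter at most 2 + 2 h, which gives the
    constants 1/6, 1/6 and 1/12.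

    No exact value of a Hausdorff measure is required, only two bounds. Above:
    the image of [0, 1] under an L-Lipschitz map has measure at most L
    (hausdorff1_lipschitz_le). Below: projecting to the first axis does not
    increase diameters, so a set has measure at least the length of an interval
    contained in its projection (projection_le_hausdorff1). Applied to the two
    long edges cut at abscissa a, the second bound says that the part of the
    boundary to the right of a has measure at least 2 (1 - a)
    (hausdorff1_boundary_triangle_ge). With h = 1 / n, a staircase with n steps
    below the abscissa then shows that its integral over the boundary is at
    least 1 - h (boundary_moment_triangle). Hence the boundary centroid has
    abscissa at least (1 - h) / (2 + 2 h) >= 1/2 - h (centroid_gap_triangle).

    The integral is taken for the Caratheodory sigma-algebra of the Hausdorff
    outer measure, so coordinates must be shown measurable for it. This is
    Caratheodory's criterion for metric outer measures, in the form: sublevel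
    sets of 1-Lipschitz functions are measurable (caratheodory_sublevel). *)

(** * Euclidean norm and diameter *)

Section plane.
Context {R : realType}.
Implicit Types (z w : R * R) (A B : set (R * R)).

Lemma normr_fst_le_enorm z : `|z.1| <= enorm z.
Proof.
rewrite -sqrtr_sqr; apply: ler_wsqrtr.
by rewrite /dotp -!expr2 lerDl sqr_ge0.
Qed.

Lemma normr_snd_le_enorm z : `|z.2| <= enorm z.
Proof.
rewrite -sqrtr_sqr; apply: ler_wsqrtr.
by rewrite /dotp -!expr2 lerDr sqr_ge0.
Qed.

Lemma enorm_le_normrD z : enorm z <= `|z.1| + `|z.2|.
Proof.
rewrite -[leRHS]ger0_norm ?addr_ge0// -sqrtr_sqr; apply: ler_wsqrtr.
rewrite /dotp -!expr2 sqrrD !real_normK ?num_real//.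
by rewrite lerD2r lerDl mulrn_wge0 ?mulr_ge0.
Qed.

Lemma ediam_le A (d : R) : 0 <= d ->
  (forall z w, A z -> A w -> enorm (z - w) <= d) -> (ediam A <= d%:E)%E.
Proof.
move=> d0 Ad; rewrite /ediam ge_max lee_fin d0/=.
by apply: ge_ereal_sup => _ [[z w] /= [Az Aw] <-]; rewrite lee_fin Ad.
Qed.

Lemma enorm_le_ediam {A z w} : A z -> A w -> ((enorm (z - w))%:E <= ediam A)%E.
Proof.
move=> Az Aw; rewrite /ediam le_max; apply/orP; right.
by apply: ereal_sup_ubound; exists (z, w).
Qed.

Lemma le_ediam A B : A `<=` B -> (ediam A <= ediam B)%E.
Proof.
move=> AB; rewrite /ediam ge_max le_max lexx/=.
by apply: ge_ereal_sup => _ [[z w] /= [Az Aw] <-]; apply: enorm_le_ediam; exact: AB.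
Qed.

(** * Two bounds for the one-dimensional Hausdorff measure *)

(** A set of diameter d projects into a closed interval of length at most d;
    the intervals obtained from a cover of A cover [a, b[, and Lebesgue measure
    is countably subadditive. The interval is half-open because the edge of a
    triangle will be used without its right endpoint. *)
Lemma projection_le_hausdorff1 A (a b : R) :
  `[a, b[%classic `<=` [set z.1 | z in A] -> ((b - a)%:E <= hausdorff1 A)%E.
Proof.
move=> abA; apply: le_trans (hausdorff1_pre_le A ltr01).
apply: le_ereal_inf_tmp => _ [F [F1 AF] <-].
pose S k := [set z.1 | z in F k].
pose I k : set R := if F k == set0 then set0 else `[inf (S k), sup (S k)]%classic.
have mI k : measurable (I k) by rewrite /I; case: ifP.
have FI k z : F k z -> I k z.1 /\ (lebesgue_measure (I k) <= ediam (F k))%E.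
  move=> Fz; have Fk0 : F k !=set0 by exists z.
  have Fd v w : F k v -> F k w -> ((v.1 - w.1)%:E <= ediam (F k))%E.
    move=> Fv Fw; apply: le_trans (enorm_le_ediam Fv Fw).
    rewrite lee_fin; apply: le_trans (normr_fst_le_enorm _).
    exact: ler_norm.
  have fd : ediam (F k) \is a fin_num.
    by rewrite ge0_fin_numE ?ediam_ge0// (le_lt_trans (F1 k)) ?ltry.
  have Fd' v w : F k v -> F k w -> v.1 - w.1 <= fine (ediam (F k)).
    by move=> Fv Fw; rewrite -lee_fin fineK// Fd.
  have S0 : S k !=set0 by exists z.1; exists z.
  have ubS : has_ubound (S k).
    exists (z.1 + fine (ediam (F k))) => _ [w Fw <-].
    by rewrite addrC -lerBlDr Fd'.
  have lbS : has_lbound (S k).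
    exists (z.1 - fine (ediam (F k))) => _ [w Fw <-].
    by rewrite lerBlDr addrC -lerBlDr Fd'.
  have Sz : S k z.1 by exists z.
  rewrite /I; case: ifPn => [/eqP F0|_]; first by rewrite F0 in Fz.
  split.
    by rewrite /= in_itv/= ub_le_sup// ge_inf.
  rewrite lebesgue_measure_itv/=; case: ifPn => [_|_]; last exact: ediam_ge0.
  rewrite -[leRHS]fineK// -EFinD lee_fin lerBlDr.
  apply: ge_sup => // _ [v Fv <-]; rewrite -lerBlDl.
  apply: lb_le_inf => // _ [w Fw <-].
  by rewrite lerBlDr -lerBlDl Fd'.
have Ile k : (lebesgue_measure (I k) <= ediam (F k))%E.
  have [F0|/set0P[z /FI[]//]] := eqVneq (F k) set0.
  by rewrite /I F0 eqxx measure0 ediam_ge0.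
have abI : `[a, b[%classic `<=` \bigcup_k I k.
  move=> x /abA[z /AF[k _ Fz] <-]; exists k => //.
  by have [] := FI _ _ Fz.
apply: (@le_trans _ _ (\sum_(k <oo) lebesgue_measure (I k))%E); last first.
  by apply: lee_nneseries => // k *; exact: Ile.
apply: (@le_trans _ _ (lebesgue_measure (`[a, b[%classic : set R))).
  rewrite lebesgue_measure_itv/= lte_fin; case: ltP => // ba.
  by rewrite lee_fin subr_le0.
by apply: measure_sigma_subadditive => //.
Qed.

(** Cutting [0, 1] into N equal pieces gives images of diameter at most L / N,
    with total at most L; N is large enough for L / N <= d. *)
Lemma hausdorff1_lipschitz_le (f : R -> R * R) (L : R) : 0 <= L ->
  (forall s t, enorm (f s - f t) <= L * `|s - t|) ->
  (hausdorff1 (f @` `[0%R, 1%R]) <= L%:E)%E.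
Proof.
move=> L0 fL; apply: ge_ereal_sup => _ [d /= d0 <-].
pose N := (Num.truncn (L / d)).+1.
have N0 : (0 < N%:R :> R) by rewrite ltr0n.
have LN : L / N%:R <= d.
  rewrite ler_pdivrMr// mulrC -ler_pdivrMr//; apply/ltW.
  by rewrite /N truncnS_gt// divr_ge0// ltW.
pose F k : set (R * R) :=
  if (k < N)%N then f @` `[k%:R / N%:R, k.+1%:R / N%:R] else set0.
have Fd k : (ediam (F k) <= if (k < N)%N then (L / N%:R)%:E else 0)%E.
  rewrite /F; case: ifPn => [kN|_]; last by rewrite ediam0.
  apply: ediam_le; first by rewrite divr_ge0.
  move=> _ _ [s /= + <-] [t /= + <-]; rewrite !in_itv/= => /andP[s1 s2] /andP[t1 t2].
  apply: le_trans (fL s t) _; apply: ler_wpM2l => //.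
  have e : k.+1%:R / N%:R = k%:R / N%:R + N%:R^-1 :> R.
    by rewrite -natr1 mulrDl mul1r.
  rewrite e in s2 t2; rewrite ler_norml; apply/andP; split; lra.
have cF : small_cover d (f @` `[0%R, 1%R]) F.
  split=> [k|_ [x /= + <-]].
    apply: le_trans (Fd k) _; case: ifP => _; rewrite lee_fin//.
    exact: ltW.
  rewrite in_itv/= => /andP[x0 x1].
  have xN0 : 0 <= x * N%:R by rewrite mulr_ge0// ltW.
  have /andP[l u] := truncn_itv xN0.
  (* The piece of index floor(x N) contains f x, except that x = 1 belongs to
     the last piece, of index N - 1. *)
  have [x1'|/negP] := boolP (x < 1).
    exists (Num.truncn (x * N%:R)) => //.
    rewrite /F; case: ifPn => [_|]; last first.
      rewrite -leqNgt => NN; exfalso.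
      have : N%:R <= x * N%:R by apply: le_trans l; rewrite ler_nat.
      by rewrite ler_pMl// leNgt x1'.
    exists x => //=; rewrite in_itv/= ler_pdivrMr// ler_pdivlMr// l/=.
    exact/ltW.
  move/negP; rewrite -leNgt => x1'.
  have -> : x = 1 by apply/eqP; rewrite eq_le x1 x1'.
  exists N.-1 => //; rewrite /F /= leqnn; exists 1 => //=.
  rewrite in_itv/= divff ?gt_eqF// lexx andbT ler_pdivrMr// mul1r ler_nat.
  exact: leqnSn.
apply: (@le_trans _ _ (\sum_(k <oo) ediam (F k))%E).
  by apply: ereal_inf_lbound; exists F.
rewrite (nneseries_split 0 N) ?add0n; last by move=> *; exact: ediam_ge0.
rewrite [X in (_ + X)%E]eseries0 ?adde0; last first.
  by move=> k Nk _; rewrite /F ltnNge Nk/= ediam0.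
apply: (@le_trans _ _ (\sum_(0 <= k < N) (L / N%:R)%:E)%E).
  rewrite !big_mkord; apply: lee_sum => k _; apply: le_trans (Fd k) _.
  by rewrite ltn_ord.
rewrite sumEFin lee_fin big_mkord sumr_const card_ord.
by rewrite -(mulr_natr (L / N%:R)) divfK// gt_eqF.
Qed.

End plane.

(** * Caratheodory's criterion *)

Section metric_outer_measure.
Context {R : realType}.
Variable g : R * R -> R.
Hypothesis g1 : forall z w, `|g z - g w| <= enorm (z - w).
Implicit Types A B X : set (R * R).
Local Open Scope ereal_scope.

Lemma hausdorff1_pre_anti A (d e : R) : (d <= e)%R ->
  hausdorff1_pre e A <= hausdorff1_pre d A.
Proof.
move=> de; apply: ereal_inf_le_tmp => _ [F [Fd AF] <-]; exists F => //.
by split=> // k; rewrite (le_trans (Fd k))// lee_fin.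
Qed.

(** A set of diameter less than t - s cannot meet both A and B, so a
    sufficiently fine cover of the union splits into a cover of A and a cover
    of B without any diameter being counted twice. *)
Lemma hausdorff1_separated {A B} {s t : R} : (s < t)%R ->
  (forall z, A z -> g z <= s)%R -> (forall z, B z -> t <= g z)%R ->
  hausdorff1 A + hausdorff1 B <= hausdorff1 (A `|` B).
Proof.
move=> st As Bt.
have H (d e : R) : (0 < d)%R -> (0 < e)%R ->
    hausdorff1_pre d A + hausdorff1_pre e B <= hausdorff1 (A `|` B).
  (* Restricting to covers of mesh c only increases the premeasures. *)
  move=> d0 e0; set c := (Num.min (Num.min d e) ((t - s) / 2))%R.
  have c0 : (0 < c)%R by rewrite !lt_min d0 e0 divr_gt0// subr_gt0.
  have cd : (c <= d)%R by rewrite !ge_min lexx.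
  have ce : (c <= e)%R by rewrite !ge_min lexx orbT.
  have cst : (c < t - s)%R.
    rewrite (@le_lt_trans _ _ ((t - s) / 2)%R)//; first by rewrite /c !ge_min lexx !orbT.
    by lra.
  apply: (@le_trans _ _ (hausdorff1_pre c A + hausdorff1_pre c B)).
    by apply: leeD; exact: hausdorff1_pre_anti.
  apply: le_trans (hausdorff1_pre_le _ c0).
  apply: le_ereal_inf_tmp => _ [F [Fd ABF] <-].
  apply: (@le_trans _ _ (\sum_(k <oo) ediam (F k `&` A) + \sum_(k <oo) ediam (F k `&` B))).
    apply: leeD; apply: ereal_inf_lbound.
    - exists (fun k => F k `&` A) => //; split=> [k|z Az].
        by apply: le_trans (Fd k); apply: le_ediam; exact: subIsetl.
      by have [k _ Fz] := ABF _ (or_introl Az); exists k.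
    - exists (fun k => F k `&` B) => //; split=> [k|z Bz].
        by apply: le_trans (Fd k); apply: le_ediam; exact: subIsetl.
      by have [k _ Fz] := ABF _ (or_intror Bz); exists k.
  rewrite -nneseriesD; [|by move=> *; exact: ediam_ge0..].
  apply: lee_nneseries => [k _ _|k _]; first by rewrite adde_ge0 ?ediam_ge0.
  have [[z [Fz Az]]|/set0P/negP/negPn/eqP ->] := pselect (F k `&` A !=set0).
    have -> : F k `&` B = set0.
      rewrite -subset0 => w [Fw Bw].
      have : (enorm (w - z))%:E <= c%:E by apply: le_trans (Fd k); exact: enorm_le_ediam.
      have := g1 w z; have := ler_norm (g w - g z); have := As _ Az; have := Bt _ Bw.
      rewrite lee_fin; lra.
    by rewrite ediam0 adde0; apply: le_ediam; exact: subIsetl.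
  by rewrite ediam0 add0e; apply: le_ediam; exact: subIsetl.
have [->|fin] := eqVneq (hausdorff1 (A `|` B)) +oo; first exact: leey.
have ltoo X : X `<=` A `|` B -> hausdorff1 X \is a fin_num.
  move=> XAB; rewrite ge0_fin_numE ?hausdorff1_ge0//.
  by rewrite (le_lt_trans (le_hausdorff1 XAB))// ltey.
have fA := ltoo A (@subsetUl _ _ _).
have fpB (e : R) : (0 < e)%R -> hausdorff1_pre e B \is a fin_num.
  move=> e0; rewrite ge0_fin_numE ?hausdorff1_pre_ge0//.
  rewrite (le_lt_trans (hausdorff1_pre_le _ e0))//.
  by rewrite -ge0_fin_numE ?hausdorff1_ge0// ltoo.
rewrite addeC -leeBrDr//; apply: ge_ereal_sup => _ [e /= e0 <-].
rewrite leeBrDr// addeC -leeBrDr ?fpB//; apply: ge_ereal_sup => _ [d /= d0 <-].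
by rewrite leeBrDr ?fpB// H.
Qed.

(** Let T n increase to a, U n be the part of X where g < T n, and B n the layer
    T n <= g < T (n + 1). The sets U n and X minus the sublevel set are
    separated, hence additive; it remains to let n tend to infinity. What U n
    misses is covered by the layers B n, B (n + 1), and so on, so it suffices
    that the measures of the layers form a convergent series. Consecutive
    layers touch, but U n and B (n + 1) are separated and lie in U (n + 2),
    which makes the sum of measures telescope (sumB below). *)
Lemma caratheodory_sublevel (a : R) :
  hausdorff1.-caratheodory [set z | (g z < a)%R].
Proof.
apply: le_caratheodory_measurable => X /=.
have [->|fin] := eqVneq (hausdorff1 X) +oo; first exact: leey.
pose T n : R := (a - n.+1%:R^-1)%R.
have TS n : (T n < T n.+1)%R.
  by rewrite ltrD2l ltrN2 ltf_pV2 ?posrE ?ltr0n// ltr_nat.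
have Ta n : (T n < a)%R by rewrite ltrBlDr ltrDl invr_gt0 ltr0n.
pose U n := X `&` [set z | (g z < T n)%R].
pose B n := X `&` [set z | (T n <= g z < T n.+1)%R].
have HX Y : Y `<=` X -> hausdorff1 Y <= hausdorff1 X by exact: le_hausdorff1.
have UB n : hausdorff1 (U n) + hausdorff1 (B n.+1) <= hausdorff1 (U n.+2).
  apply: le_trans (hausdorff1_separated (TS n) _ _) _.
  - by move=> z [_ /ltW].
  - by move=> z [_ /andP[]].
  - apply: le_hausdorff1 => z [[Xz /= gz]|[Xz /= /andP[_ gz]]]; split => //=.
    by rewrite (lt_trans gz)// (lt_trans (TS n)).
have sumB n : \sum_(0 <= k < n) hausdorff1 (B k.+1) <=
    hausdorff1 (U n) + hausdorff1 (U n.+1).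
  elim: n => [|n ih]; first by rewrite big_geq// adde_ge0// hausdorff1_ge0.
  rewrite big_nat_recr//=; apply: le_trans (leeD ih (lexx _)) _.
  by rewrite addeAC addeC leeD2l.
have sumBoo : \sum_(0 <= k <oo) hausdorff1 (B k.+1) < +oo.
  apply: (@le_lt_trans _ _ (hausdorff1 X + hausdorff1 X)); last first.
    by rewrite lte_add_pinfty// ltey.
  apply: lime_le; first by apply: is_cvg_nneseries => *; exact: hausdorff1_ge0.
  near=> n; apply: le_trans (sumB n) _.
  by apply: leeD; apply: HX; exact: subIsetl.
have tail := nneseries_tail_cvg sumBoo (fun k _ => hausdorff1_ge0 _).
have main n : hausdorff1 (X `&` [set z | (g z < a)%R]) +
    hausdorff1 (X `&` ~` [set z | (g z < a)%R]) <=
    hausdorff1 X + \sum_(n <= k <oo) hausdorff1 (B k.+1).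
  apply: (@le_trans _ _ ((hausdorff1 (U n.+1) + \sum_(n <= k <oo) hausdorff1 (B k.+1)) +
     hausdorff1 (X `&` ~` [set z | (g z < a)%R]))).
    apply: leeD => //.
    apply: (@le_trans _ _ (hausdorff1 (U n.+1 `|` \bigcup_(k in ~` `I_n) B k.+1))).
      apply: le_hausdorff1 => z [Xz /= gza].
      have [gT|Tg] := ltP (g z) (T n.+1); first by left.
      right.
      (* The least m with g z < T m locates z in the layer of index m - 1. *)
      have exm : exists m, (g z < T m)%R.
        exists (Num.truncn (a - g z)^-1).
        rewrite ltrBrDl -ltrBrDr -[ltRHS]invrK ltf_pV2 ?posrE ?invr_gt0 ?subr_gt0//.
        by rewrite truncnS_gt// invr_ge0 subr_ge0 ltW.
      case: (ex_minnP exm) => m gm mm.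
      have Tmono i j : (i <= j)%N -> (T i <= T j)%R.
        move=> ij; rewrite lerD2l lerN2 lef_pV2 ?posrE ?ltr0n//.
        by rewrite ler_nat.
      have nm : (n.+1 < m)%N.
        rewrite ltnNge; apply/negP => /Tmono; rewrite leNgt => /negP; apply.
        exact: le_lt_trans Tg gm.
      case: m gm mm nm => // -[//|m] gm mm nm.
      exists m => /=; first by rewrite /= /mkset; apply/negP; rewrite -leqNgt.
      split=> //=; rewrite gm andbT leNgt; apply/negP => /mm.
      by rewrite ltnn.
    apply: le_trans (outer_measureU2 hausdorff1 _ _) _; apply: leeD => //.
    exact: (outer_measure_sigma_subadditive_tail hausdorff1).
  rewrite addeAC; apply: leeD => //.
  apply: le_trans (hausdorff1_separated (Ta n.+1) _ _) _.
  - by move=> z [_ /ltW].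
  - by move=> z [_ /negP]; rewrite -leNgt.
  - by apply: HX => z [[]|[]].
rewrite -[leRHS]adde0.
have cvgX : (hausdorff1 X + \sum_(n <= k <oo) hausdorff1 (B k.+1)) @[n --> \oo] -->
   hausdorff1 X + 0.
  apply: cvgeD => //; last exact: cvg_cst.
  by rewrite fin_num_adde_defl.
rewrite -(cvg_lim _ cvgX)//; apply: lime_ge; first by apply/cvg_ex; eexists; exact: cvgX.
by apply: nearW => n; exact: main.
Unshelve. all: by end_near. Qed.

Lemma measurable_hausdorff1_lipschitz :
  measurable_fun [set: caratheodory_type (@hausdorff1 R)] g.
Proof.
apply: (measurability _ (RGenInftyO.measurableE R)).
move=> _ [_ [a ->] <-]; rewrite setTI.
have -> : g @^-1` `]-oo, a[%classic = [set z | (g z < a)%R].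
  by apply/seteqP; split => z /=; rewrite in_itv.
exact: caratheodory_sublevel.
Qed.

End metric_outer_measure.

Lemma measurable_ler (R : realType) (d : measure_display) (T : measurableType d)
    (f g : T -> R) :
  measurable_fun setT f -> measurable_fun setT g ->
  measurable [set x | f x <= g x].
Proof.
move=> mf mg; have := measurable_fun_ler mf mg measurableT (I : measurable [set true]).
by rewrite setTI.
Qed.

(** * The thin triangle and its boundary *)

Definition triangle (R : realType) (h : R) : set (R * R) :=
  [set z | [/\ 0 <= z.1, 0 <= z.2 & z.2 <= h * (1 - z.1)]].

Section triangle_shape.
Context {R : realType} (h : R).
Hypothesis h0 : 0 < h.
Let T := triangle R h.
Implicit Type z : R * R.

Lemma triangle_fst_le1 z : T z -> z.1 <= 1.
Proof.
move=> [_ z2 zh]; have := le_trans z2 zh.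
by rewrite pmulr_rge0// subr_ge0.
Qed.

Lemma triangle_snd_le z : T z -> z.2 <= h.
Proof. by move=> [z1 _ /le_trans]; apply; rewrite ger_pMr// gerBl. Qed.

Let continuous_gap : continuous (fun z : R * R => h * (1 - z.1) - z.2).
Proof.
move=> z; apply: cvgB; last exact: cvg_snd.
apply: cvgM; first exact: cvg_cst.
by apply: cvgB; [exact: cvg_cst|exact: cvg_fst].
Qed.

Lemma closed_triangle : closed T.
Proof.
have -> : T = fst @^-1` [set x | 0 <= x] `&` snd @^-1` [set x | 0 <= x] `&`
    (fun z => h * (1 - z.1) - z.2) @^-1` [set x | 0 <= x].
  apply/seteqP; split => z /=; first by move=> [? ? ?]; rewrite subr_ge0.
  by move=> [[? ?]]; rewrite subr_ge0.
by apply: closedI; [apply: closedI|]; apply: preimage_closed => [z _|];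
  rewrite /=; do ?[exact: closed_ge|exact: cvg_fst|exact: cvg_snd|exact: continuous_gap].
Qed.

Lemma compact_triangle : compact T.
Proof.
have cK : compact ((`[0, 1]%classic : set R) `*` (`[0, h]%classic : set R)).
  by apply: compact_setX; exact: segment_compact.
apply: (subclosed_compact closed_triangle cK).
move=> z Tz; have [z1 z2 _] := Tz; split; rewrite /= in_itv/=.
  by rewrite z1 triangle_fst_le1.
by rewrite z2 triangle_snd_le.
Qed.

Lemma convex_triangle : @convex_set R (R^o * R^o)%type T.
Proof.
move=> x y t; rewrite !inE => -[x1 x2 xh] [y1 y2 yh].
have t0 : 0 <= t%:num :> R by [].
have t1 : 0 <= 1 - t%:num :> R by rewrite subr_ge0.
have E1 : (conv t x y).1 = t%:num * x.1 + (1 - t%:num) * y.1 by [].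
have E2 : (conv t x y).2 = t%:num * x.2 + (1 - t%:num) * y.2 by [].
split; rewrite ?E1 ?E2.
- by rewrite addr_ge0// mulr_ge0.
- by rewrite addr_ge0// mulr_ge0.
- have := ler_wpM2l t0 xh; have := ler_wpM2l t1 yh; lra.
Qed.

(** An interior point can be moved by e / 2 to the left, downwards and upwards
    without leaving the triangle, which makes the three inequalities strict. *)
Lemma interior_triangle :
  interior T = [set z | [/\ 0 < z.1, 0 < z.2 & z.2 < h * (1 - z.1)]].
Proof.
apply/seteqP; split => [z|].
  move=> /nbhs_ballP[e /= e0 zeT].
  have e2 : 0 < e / 2 by rewrite divr_gt0.
  have ee : `|e / 2| < e by rewrite gtr0_norm// ltr_pdivrMr// ltr_pMr// ltr1n.
  have := zeT (z.1 - e / 2, z.2); have := zeT (z.1, z.2 - e / 2).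
  have := zeT (z.1, z.2 + e / 2).
  rewrite /triangle /=.
  case=> [|_ _ A].
    by split; [exact: ballxx|rewrite /ball/= opprD addNKr normrN].
  case=> [|_ B _].
    by split; [exact: ballxx|rewrite /ball/= opprB addrC subrK].
  case=> [|C _ _].
    by split; [rewrite /ball/= opprB addrC subrK|exact: ballxx].
  by move: A B C => /= A B C; split; lra.
have -> : [set z | [/\ 0 < z.1, 0 < z.2 & z.2 < h * (1 - z.1)]] =
    fst @^-1` [set x : R | 0 < x] `&` snd @^-1` [set x : R | 0 < x] `&`
    (fun z => h * (1 - z.1) - z.2) @^-1` [set x : R | 0 < x].
  apply/seteqP; split => z /=; first by move=> [? ? ?]; rewrite subr_gt0.
  by move=> [[? ?]]; rewrite subr_gt0.
rewrite -open_subsetE.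
  by move=> z [[/= z1 z2]]; rewrite subr_gt0 => zh; split; exact: ltW.
by apply: openI; [apply: openI|]; apply: open_comp => [z _|];
  rewrite /=; do ?[exact: open_gt|exact: cvg_fst|exact: cvg_snd|exact: continuous_gap].
Qed.

Lemma convex_body_triangle : convex_body T.
Proof.
split; [exact: compact_triangle|exact: convex_triangle|].
have e : [/\ (0 : R) < 1 / 4, 0 < h / 4 & h / 4 < h * (1 - 1 / 4)] by split; move: h0; lra.
by exists (1 / 4, h / 4); rewrite interior_triangle.
Qed.

Lemma boundary_triangle : boundary T =
  [set z | T z /\ [\/ z.1 = 0, z.2 = 0 | z.2 = h * (1 - z.1)]].
Proof.
rewrite /boundary -(closure_id _).1; last exact: closed_triangle.
rewrite interior_triangle; apply/seteqP; split => z /=.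
  move=> [Tz nz]; split=> //; have [z1 z2 zh] := Tz.
  have [z1'|z1'] := ltP 0 z.1; last by apply: Or31; apply/eqP; rewrite eq_le z1 z1'.
  have [z2'|z2'] := ltP 0 z.2; last by apply: Or32; apply/eqP; rewrite eq_le z2 z2'.
  have [zh'|zh'] := ltP z.2 (h * (1 - z.1)); first by exfalso; apply: nz.
  by apply: Or33; apply/eqP; rewrite eq_le zh zh'.
by move=> [Tz] e; split => // -[z1 z2 zh]; case: e; lra.
Qed.

Lemma width_triangle : width T (1, 0) = 1.
Proof.
have -> : width T (1, 0) = sup [set z.1 | z in T] - inf [set z.1 | z in T].
  rewrite /width; suff -> : (fun z : R * R => dotp z (1, 0)) = fst by [].
  by apply/funext => z; rewrite /dotp/= mulr1 mulr0 addr0.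
have T1 : T (1, 0) by split => //=; rewrite subrr mulr0.
have T0 : T (0, 0) by split => //=; rewrite subr0 mulr1 ltW.
have ub : ubound [set z.1 | z in T] 1 by move=> _ [z /triangle_fst_le1 ? <-].
have lb : lbound [set z.1 | z in T] 0 by move=> _ [z [? _ _] <-].
have -> : sup [set z.1 | z in T] = 1.
  apply/eqP; rewrite eq_le ge_sup//=; last by exists 0; exists (0, 0).
  by apply: ub_le_sup; [exists 1|exists (1, 0)].
have -> : inf [set z.1 | z in T] = 0.
  apply/eqP; rewrite eq_le lb_le_inf ?andbT//=; last by exists 0; exists (0, 0).
  by apply: ge_inf; [exists 0|exists (0, 0)].
by rewrite subr0.
Qed.

Lemma ediam_triangle : (ediam T <= (1 + h)%:E)%E.
Proof.
apply: ediam_le => [|z w Tz Tw]; first by rewrite addr_ge0// ltW.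
have [z1 z2 _] := Tz; have [w1 w2 _] := Tw.
have := triangle_fst_le1 _ Tz; have := triangle_fst_le1 _ Tw.
have := triangle_snd_le _ Tz; have := triangle_snd_le _ Tw.
move=> ? ? ? ?; apply: le_trans (enorm_le_normrD _) _.
by apply: lerD; rewrite ler_norml /=; apply/andP; split; lra.
Qed.

Lemma diameter_triangle : 0 <= diameter T <= 1 + h.
Proof.
have /andP[d0 dh] : (0 <= ediam T <= (1 + h)%:E)%E by rewrite ediam_ge0 ediam_triangle.
rewrite /diameter fine_ge0//= -lee_fin fineK//.
by rewrite ge0_fin_numE// (le_lt_trans dh)// ltry.
Qed.

End triangle_shape.

Section triangle_boundary.
Context {R : realType} (h : R).
Hypothesis h0 : 0 < h.
Let T := triangle R h.

Lemma hausdorff1_boundary_triangle_le : (hausdorff1 (boundary T) <= (2 + 2 * h)%:E)%E.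
Proof.
pose f1 (t : R) : R * R := (t, 0).
pose f2 (t : R) : R * R := (t, h * (1 - t)).
pose f3 (t : R) : R * R := (0, h * t).
have sub : boundary T `<=` (f1 @` `[0, 1] `|` f2 @` `[0, 1]) `|` f3 @` `[0, 1].
  rewrite boundary_triangle// => -[x y] [Tz].
  have x1 : x <= 1 := triangle_fst_le1 _ h0 _ Tz.
  have yh : y <= h := triangle_snd_le _ h0 _ Tz.
  case: Tz => /= x0 y0 _ [->|->|->].
  - right; exists (y / h); last by rewrite /f3 mulrC divfK// gt_eqF.
    by rewrite /= in_itv/= divr_ge0 ?(ltW h0)//= ler_pdivrMr// mul1r.
  - by left; left; exists x => //=; rewrite in_itv/= x0.
  - by left; right; exists x => //=; rewrite in_itv/= x0.
apply: le_trans (le_hausdorff1 sub) _.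
apply: le_trans (outer_measureU2 (@hausdorff1 R) _ _) _.
have -> : (2 + 2 * h)%:E = ((1%:E + (1 + h)%:E) + h%:E)%E.
  by rewrite -!EFinD; congr (_%:E); lra.
apply: leeD; first apply: le_trans (outer_measureU2 (@hausdorff1 R) _ _) _; first apply: leeD.
- apply: hausdorff1_lipschitz_le => // s t; apply: le_trans (enorm_le_normrD _) _.
  by rewrite /= subrr normr0 addr0 mul1r.
- apply: hausdorff1_lipschitz_le => [|s t]; first by rewrite addr_ge0// ltW.
  apply: le_trans (enorm_le_normrD _) _.
  have -> : (f2 s - f2 t).2 = h * (t - s) by rewrite /f2/=; ring.
  by rewrite /= normrM (gtr0_norm h0) (distrC t s) mulrDl mul1r.
- apply: hausdorff1_lipschitz_le => [|s t]; first exact: ltW.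
  apply: le_trans (enorm_le_normrD _) _.
  by rewrite /= subrr normr0 add0r -mulrBr normrM (gtr0_norm h0).
Qed.

(** The line of the horizontal edge separates the boundary measurably into this
    edge and the rest; on either side of the cut the projection contains
    [a, 1[. *)
Lemma hausdorff1_boundary_triangle_ge (a : R) : 0 <= a ->
  ((2 * (1 - a))%:E <= hausdorff1 (boundary T `&` [set z | (a <= z.1)%R]))%E.
Proof.
move=> a0; set S := _ `&` _.
have := caratheodory_sublevel (fun z : R * R => - z.2) _ 0 S.
(* Measurability of the half-plane z.2 > 0 splits S. *)
rewrite /= => ->; last first.
  move=> z w; rewrite -opprD normrN; exact: (normr_snd_le_enorm (z - w)).
have -> : (2 * (1 - a))%:E = ((1 - a)%:E + (1 - a)%:E)%E.
  by rewrite -EFinD; congr (_%:E); lra.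
apply: leeD; apply: projection_le_hausdorff1 => x /=; rewrite in_itv/= => /andP[ax x1].
  have hx : 0 < h * (1 - x) by rewrite mulr_gt0// subr_gt0.
  exists (x, h * (1 - x)) => //; split; last by rewrite /= oppr_lt0.
  split => //; rewrite boundary_triangle//; split; last exact: Or33.
  by split => //=; [exact: le_trans ax|exact: ltW].
exists (x, 0) => //; split; last by rewrite /= oppr0 ltxx.
split => //; rewrite boundary_triangle//; split; last exact: Or32.
by split => //=; [exact: le_trans ax|rewrite mulr_ge0 ?(ltW h0)// subr_ge0 ltW].
Qed.

Lemma measurable_fst_hausdorff1 :
  measurable_fun [set: caratheodory_type (@hausdorff1 R)] fst.
Proof. by apply: measurable_hausdorff1_lipschitz => z w; exact: (normr_fst_le_enorm (z - w)). Qed.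

Lemma measurable_snd_hausdorff1 :
  measurable_fun [set: caratheodory_type (@hausdorff1 R)] snd.
Proof. by apply: measurable_hausdorff1_lipschitz => z w; exact: (normr_snd_le_enorm (z - w)). Qed.

End triangle_boundary.

(** * The integral of the abscissa over the boundary *)

(** The sum is the integer part of y, capped at n. *)
Lemma sum_steps_le (R : realType) (n : nat) (y : R) : 0 <= y ->
  \sum_(i < n) (i.+1%:R <= y)%R%:R <= y.
Proof.
move=> y0; suff : \sum_(i < n) (i.+1%:R <= y)%R%:R <= Num.min n%:R y by rewrite le_min => /andP[].
elim: n => [|n ih]; first by rewrite big_ord0 le_min lexx.
move: ih; rewrite big_ord_recr/= !le_min => /andP[i1 i2].
case: (leP n.+1%:R y) => ny; last by rewrite mulr0n addr0 i2 andbT (le_trans i1)// ler_nat.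
rewrite mulr1n -natr1 in ny *; apply/andP; split; lra.
Qed.

Lemma sum_ord_succ (R : realType) (n : nat) :
  \sum_(i < n) (i.+1%:R : R) = n%:R * (n%:R + 1) / 2.
Proof.
elim: n => [|n ih]; first by rewrite big_ord0 mul0r mul0r.
by rewrite big_ord_recr/= ih -natr1; field.
Qed.

Section boundary_moment.
Context {R : realType} (h : R).
Hypothesis h0 : 0 < h.
Let T := triangle R h.
Let mu := hausdorff1_measure R.

Lemma measurable_boundary_triangle :
  measurable (boundary T : set (caratheodory_type (@hausdorff1 R))).
Proof.
have mf := @measurable_fst_hausdorff1 R.
have ms := @measurable_snd_hausdorff1 R.
have mg : measurable_fun [set: caratheodory_type (@hausdorff1 R)] (fun z => h * (1 - z.1)).
  apply: measurable_funM; first exact: measurable_cst.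
  by apply: measurable_funB; [exact: measurable_cst|exact: mf].
have m0 : measurable_fun [set: caratheodory_type (@hausdorff1 R)] (fun=> (0 : R)) by [].
rewrite boundary_triangle//.
have -> : [set z | T z /\ [\/ z.1 = 0, z.2 = 0 | z.2 = h * (1 - z.1)]] =
   ([set z | 0 <= z.1] `&` [set z | 0 <= z.2] `&` [set z | z.2 <= h * (1 - z.1)]) `&`
   ([set z | z.1 <= 0] `|` [set z | z.2 <= 0] `|` [set z | h * (1 - z.1) <= z.2]).
  apply/seteqP; split => z /=.
    move=> [[z1 z2 zh] e]; split => //.
    by case: e => e; [left; left|left; right|right]; rewrite e.
  move=> [[[z1 z2] zh] e]; split => //.
  case: e => [[e|e]|e].
  - by apply: Or31; apply/eqP; rewrite eq_le z1 e.
  - by apply: Or32; apply/eqP; rewrite eq_le z2 e.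
  - by apply: Or33; apply/eqP; rewrite eq_le zh e.
apply: measurableI; first apply: measurableI; first apply: measurableI.
- exact: measurable_ler.
- exact: measurable_ler.
- exact: measurable_ler.
- by apply: measurableU; [apply: measurableU|]; exact: measurable_ler.
Qed.

Lemma hausdorff1_boundary_triangle_fin : hausdorff1 (boundary T) \is a fin_num.
Proof.
rewrite ge0_fin_numE ?hausdorff1_ge0//.
by rewrite (le_lt_trans (hausdorff1_boundary_triangle_le _ h0))// ltry.
Qed.

Lemma perimeter_triangle : 2 <= perimeter T <= 2 + 2 * h.
Proof.
rewrite -!lee_fin /perimeter fineK ?hausdorff1_boundary_triangle_fin//.
rewrite hausdorff1_boundary_triangle_le// andbT.
have := hausdorff1_boundary_triangle_ge _ h0 0 (lexx _).
rewrite subr0 mulr1 => /le_trans; apply.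
by apply: le_hausdorff1; exact: subIsetl.
Qed.

(** On the boundary the abscissa dominates the step function with a jump 1 / n
    at each (i + 1) / n. Integrated step by step, with at least
    2 (1 - (i + 1) / n) of boundary to the right of the i-th jump, it yields
    1 - 1 / n. *)
Lemma boundary_moment_triangle (n : nat) : (0 < n)%N ->
  1 - n%:R^-1 <= \int[mu]_(z in boundary T) z.1.
Proof.
move=> n0; have n0' : 0 < n%:R :> R by rewrite ltr0n.
have mB := measurable_boundary_triangle.
have Bge z : boundary T z -> 0 <= z.1 by rewrite boundary_triangle// => -[[]].
have Ble z : boundary T z -> z.1 <= 1.
  by rewrite boundary_triangle// => -[/(triangle_fst_le1 _ h0)].
have mf : measurable_fun (boundary T : set (caratheodory_type (@hausdorff1 R)))
    (fun z => z.1%:E).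
  apply/measurable_EFinP; apply: measurable_funTS.
  exact: measurable_fst_hausdorff1.
rewrite -lee_fin /Rintegral fineK; last first.
  rewrite ge0_fin_numE; last by apply: integral_ge0 => z Bz; rewrite lee_fin Bge.
  apply: (@le_lt_trans _ _ (\int[mu]_(z in boundary T) 1)%E).
    apply: (ge0_le_integral mu mB) => [z Bz||| z Bz].
    - by rewrite lee_fin Bge.
    - exact: mf.
    - exact: measurable_cst.
    - by rewrite lee_fin Ble.
  rewrite integral_cst// mul1e -ge0_fin_numE ?hausdorff1_ge0//.
  exact: hausdorff1_boundary_triangle_fin.
pose A (i : 'I_n) : set (caratheodory_type (@hausdorff1 R)) :=
  [set z | i.+1%:R / n%:R <= z.1].
have mA i : measurable (A i).
  by apply: measurable_ler; [exact: measurable_cst|exact: measurable_fst_hausdorff1].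
have mstep i : measurable_fun (boundary T : set (caratheodory_type (@hausdorff1 R)))
    (fun z => (n%:R^-1 * \1_(A i) z)%:E).
  apply/measurable_EFinP; apply: measurable_funM; first exact: measurable_cst.
  by apply: measurable_indic; exact: mA.
apply: (@le_trans _ _ (\int[mu]_(z in boundary T)
    \sum_(i < n) (n%:R^-1 * \1_(A i) z)%:E)%E); last first.
  apply: (ge0_le_integral mu mB) => [z Bz||| z Bz].
  - apply: sume_ge0 => i _.
    by rewrite lee_fin mulr_ge0// invr_ge0 ltW.
  - by apply: emeasurable_sum => i; exact: mstep.
  - exact: mf.
  rewrite sumEFin lee_fin -mulr_sumr mulrC ler_pdivrMr//.
  apply: le_trans (@sum_steps_le _ n _ _); last by rewrite mulr_ge0 ?Bge// ltW.
  apply: ler_sum => i _; rewrite indicE.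
  have -> : (z \in A i) = (i.+1%:R / n%:R <= z.1) by apply/idP/idP; rewrite inE.
  by rewrite ler_pdivrMr.
rewrite ge0_integral_sum; last 3 first.
- exact: mB.
- exact: mstep.
- by move=> i z _; rewrite lee_fin mulr_ge0// invr_ge0 ltW.
apply: (@le_trans _ _ (\sum_(i < n) (n%:R^-1 * (2 * (1 - i.+1%:R / n%:R)))%:E)%E).
  rewrite sumEFin lee_fin -!mulr_sumr sumrB sumr_const card_ord -mulr_suml sum_ord_succ.
  by rewrite le_eqVlt; apply/orP; left; apply/eqP; field; rewrite gt_eqF.
apply: lee_sum => i _.
under eq_integral do rewrite EFinM.
rewrite (ge0_integralZl mu mB); last 3 first.
- by apply/measurable_EFinP; apply: measurable_indic; exact: mA.
- by move=> z _; rewrite lee_fin.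
- by rewrite lee_fin invr_ge0 ltW.
rewrite (integral_indic mu mB (mA i)) EFinM lee_pmul2l//; last by rewrite lte_fin invr_gt0.
rewrite setIC; apply: (hausdorff1_boundary_triangle_ge _ h0).
by rewrite divr_ge0// ltW.
Qed.

End boundary_moment.

(** * The area centroid *)

Section area_moment.
Context {R : realType} (h : R).
Hypothesis h0 : 0 < h.
Let T := triangle R h.
Let mu := (@lebesgue_measure R \x @lebesgue_measure R)%E.

Lemma measurable_triangle : measurable T.
Proof.
have -> : T = [set z | 0 <= z.1] `&` [set z | 0 <= z.2] `&` [set z | z.2 <= h * (1 - z.1)].
  by apply/seteqP; split => z /= [] // [].
have mf := @measurable_fst _ _ R R.
have ms := @measurable_snd _ _ R R.
apply: measurableI; first apply: measurableI.
- by apply: measurable_ler; [exact: measurable_cst|exact: mf].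
- by apply: measurable_ler; [exact: measurable_cst|exact: ms].
- apply: measurable_ler; first exact: ms.
  apply: measurable_funM; first exact: measurable_cst.
  by apply: measurable_funB; [exact: measurable_cst|exact: mf].
Qed.

(** By Tonelli this is the integral over [0, 1] of the polynomial
    h (x ^ k - x ^ (k + 1)), because the vertical section at x has length
    h (1 - x). The case k = 0 gives the area and k = 1 the first moment. *)
Lemma integral_triangle_fst_exp (k : nat) :
  (\int[mu]_(z in T) (z.1 ^+ k)%:E =
   (h * (k.+1%:R^-1 - k.+2%:R^-1))%:E)%E.
Proof.
have mT := measurable_triangle.
have mf : measurable_fun setT ((fun z : R * R => (z.1 ^+ k)%:E) \_ T).
  apply: (measurable_restrictT _ mT).1.
  by apply/measurable_EFinP; apply: measurable_funX; apply: measurable_funTS;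
    exact: measurable_fst.
have f0 : forall z, (0 <= ((fun z : R * R => (z.1 ^+ k)%:E) \_ T) z)%E.
  by apply: erestrict_ge0 => z [z1 _ _]; rewrite lee_fin exprn_ge0.
rewrite integral_mkcond fubini_tonelli1; last 2 first.
- exact: mf.
- exact: f0.
pose p : {poly R} := h *: ('X^k - 'X^(k.+1)).
pose P : {poly R} := h *: (k.+1%:R^-1 *: 'X^(k.+1) - k.+2%:R^-1 *: 'X^(k.+2)).
have Pp : P^`() = p.
  rewrite /P derivZ derivB !derivZ !derivXn /=.
  rewrite -(scaler_nat k.+1 ('X^k : {poly R})) -(scaler_nat k.+2 ('X^(k.+1) : {poly R})) !scalerA !mulVf ?pnatr_eq0//.
  by rewrite !scale1r.
transitivity (\int[lebesgue_measure]_(x in `[0%R, 1%R]) (p.[x])%:E)%E; last first.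
  rewrite (@continuous_FTC2 _ (horner p) (horner P))//.
  - have PE x : P.[x] = h * (k.+1%:R^-1 * x ^+ k.+1 - k.+2%:R^-1 * x ^+ k.+2).
      by rewrite !(hornerZ, hornerD, hornerN, hornerXn).
    rewrite !PE !expr1n !expr0n/= !mulr1 !mulr0 subrr mulr0.
    by rewrite oppr0 adde0.
  - by apply: continuous_subspaceT; exact: continuous_horner.
  - split=> [x _| |]; first exact: derivable_horner.
      by apply: cvg_at_right_filter; exact: continuous_horner.
    by apply: cvg_at_left_filter; exact: continuous_horner.
  - by move=> x _; rewrite -derivE Pp.
rewrite [RHS]integral_mkcond; apply: eq_integral => x _.
rewrite /fubini_F patchE; case: ifPn => [|x01].
  rewrite inE/= in_itv/= => /andP[x0 x1].
  transitivity (\int[lebesgue_measure]_(y in `[0%R, (h * (1 - x))%R]) (x ^+ k)%:E)%E.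
    rewrite [RHS]integral_mkcond; apply: eq_integral => y _.
    rewrite !patchE; congr (if _ then _ else _).
    apply/idP/idP; rewrite !inE /T /triangle/= in_itv/=; first by move=> [_ -> ->].
    by move=> /andP[].
  have px : p.[x] = x ^+ k * (h * (1 - x)) 
    by rewrite !(hornerZ, hornerD, hornerN, hornerXn) exprS; ring.
  have hx : 0 <= h * (1 - x) by rewrite mulr_ge0 ?(ltW h0)// subr_ge0.
  rewrite integral_cst//= lebesgue_measure_itv/= lte_fin.
  case: ltP => [_|hx']; first by rewrite px oppr0 adde0 -EFinM.
  have -> : p.[x] = 0; last by rewrite mule0.
  by rewrite px (_ : h * (1 - x) = 0) ?mulr0//; apply/eqP; rewrite eq_le hx hx'.
rewrite integral0_eq// => y _; rewrite patchE; case: ifPn => //.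
rewrite inE => Tz; have [/= z1 _ _] := Tz.
by move: x01; rewrite notin_setE/= in_itv/= z1 (triangle_fst_le1 _ h0 _ Tz).
Qed.

Lemma area_centroid_triangle_fst : (area_centroid T).1 = 1 / 3.
Proof.
have aT : area T = h * (1%:R^-1 - 2%:R^-1).
  rewrite -[RHS]/(fine (h * (1%:R^-1 - 2%:R^-1))%:E) -(integral_triangle_fst_exp 0).
  under eq_integral do rewrite expr0.
  by rewrite integral_cst ?mul1e//; exact: measurable_triangle.
have mT : \int[mu]_(z in T) z.1 = h * (2%:R^-1 - 3%:R^-1).
  by rewrite -[RHS]/(fine (h * (2%:R^-1 - 3%:R^-1))%:E) -(integral_triangle_fst_exp 1).
rewrite /area_centroid/= aT mT; field.
by rewrite gt_eqF.
Qed.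

End area_moment.

(** * Comparison of the centroids *)

Lemma centroid_gap_triangle (R : realType) (n : nat) (h : R) :
  (1 < n)%N -> h = n%:R^-1 ->
  1 / 6 - h <= (boundary_centroid (triangle R h) - area_centroid (triangle R h)).1.
Proof.
move=> n1 hn; have n0 : (0 < n)%N by exact: ltnW.
have h0 : 0 < h by rewrite hn invr_gt0 ltr0n.
have h2 : 0 <= 1 / 2 - h.
  by rewrite subr_ge0 hn div1r lef_pV2 ?posrE ?ltr0n// ler_nat.
have -> : (boundary_centroid (triangle R h) - area_centroid (triangle R h)).1 =
  (boundary_centroid (triangle R h)).1 - (area_centroid (triangle R h)).1 by [].
rewrite area_centroid_triangle_fst//.
have /andP[P2 Ph] := perimeter_triangle h h0.
have I1 := boundary_moment_triangle h h0 n n0.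
rewrite lerBrDr.
have -> : 1 / 6 - h + 1 / 3 = 1 / 2 - h by lra.
rewrite /boundary_centroid /= ler_pdivlMr; last by apply: lt_le_trans P2.
apply: le_trans I1; apply: (le_trans (ler_wpM2l h2 Ph)).
rewrite -hn.
have -> : (1 / 2 - h) * (2 + 2 * h) = 1 - h - 2 * h ^+ 2 by field.
by rewrite gerBl mulr_ge0// sqr_ge0.
Qed.

(** The coefficients 1/6 - eta and 1/12 - eta of the theorem may be negative, in
    which case an upper bound Q on the size q is useless and q >= 0 is what
    makes c * q < D hold. *)
Lemma mul_lt_gap (R : realType) (c q Q D : R) :
  0 <= q <= Q -> 0 < D -> c * Q < D -> c * q < D.
Proof.
move=> /andP[q0 qQ] D0 cQ; have [c0|c0] := leP 0 c.
  by apply: le_lt_trans cQ; exact: ler_wpM2l.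
by apply: le_lt_trans D0; rewrite mulr_le0_ge0// ltW.
Qed.

Theorem mainTheorem3 (R : realType) (eta : R) (eta_gt0 : 0 < eta) :
  [/\ exists (Omega : set (R * R)) (theta : R * R),
        [/\ convex_body Omega, enorm theta = 1 &
            `|dotp (boundary_centroid Omega - area_centroid Omega) theta|
              > (1 / 6 - eta) * width Omega theta],
      exists Omega : set (R * R),
        convex_body Omega /\
        enorm (boundary_centroid Omega - area_centroid Omega)
          > (1 / 6 - eta) * diameter Omega
    & exists Omega : set (R * R),
        convex_body Omega /\
        enorm (boundary_centroid Omega - area_centroid Omega)
          > (1 / 12 - eta) * perimeter Omega].
Proof.
(* h < eta / 2 absorbs the errors of order h on both sides of each inequality;
   h <= 1/12 keeps the gap 1/6 - h positive. *)
pose n := maxn 12 (Num.truncn (2 / eta)).+1; pose h : R := n%:R^-1.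
have n0 : 0 < n%:R :> R by rewrite ltr0n leq_max.
have h0 : 0 < h by rewrite invr_gt0.
have h12 : h <= 1 / 12.
  by rewrite div1r lef_pV2 ?posrE ?ltr0n ?leq_max// ler_nat leq_max.
have heta : h < eta / 2.
  rewrite -[ltRHS]invrK ltf_pV2 ?posrE ?invr_gt0 ?divr_gt0// invf_div.
  apply: (@lt_le_trans _ _ (Num.truncn (2 / eta)).+1%:R).
    by rewrite truncnS_gt// divr_ge0// ltW.
  by rewrite ler_nat leq_max leqnn orbT.
pose T := triangle R h.
have bodyT : convex_body T by exact: convex_body_triangle.
set d := boundary_centroid T - area_centroid T.
have d1 : 1 / 6 - h <= d.1.
  by apply: (centroid_gap_triangle _ n); rewrite ?leq_max.
have d1e : d.1 <= enorm d by exact: le_trans (ler_norm _) (normr_fst_le_enorm _).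
have eh : 0 <= eta * h by rewrite mulr_ge0// ltW.
split.
- exists T, (1, 0); split=> //.
    by rewrite /enorm /dotp/= mulr1 mulr0 addr0 sqrtr1.
  rewrite width_triangle// mulr1 -/d.
  have -> : dotp d (1, 0) = d.1 by rewrite /dotp mulr1 mulr0 addr0.
  by apply: lt_le_trans (ler_norm _); lra.
- exists T; split=> //; apply: lt_le_trans d1e.
  apply: (mul_lt_gap _ _ _ _ _ (diameter_triangle h h0)); lra.
- exists T; split=> //; apply: lt_le_trans d1e.
  have /andP[P2 Ph] := perimeter_triangle h h0.
  apply: (mul_lt_gap _ _ _ (2 + 2 * h)); [|lra|lra].
  by rewrite Ph andbT; apply: le_trans P2.
Qed.
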